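(* Let $G$ be a group, let $s\ge 1$, let $m_1,\dots,m_s\ge 1$ be integers and put $m=m_1+\dots+m_s$. For each $1\le i\le s$ let $H_i\le G$ be a subgroup of index $m_i$, let $f_i:H_i\to G$ be a homomorphism, and let $T_i=\{t_{i1},\dots,t_{im_i}\}$ be a right transversal of $H_i$ in $G$ (so $G=\bigsqcup_{t\in T_i}H_it$). Let $Y=\bigsqcup_{i=1}^s T_i$, a set of size $m$, and let $\theta_i$, $\sigma$ be as in the context. Then the function $\varphi:G\to\mathcal{A}(Y)$ defined recursively by $$g^{\varphi}=\left(\theta_i(g,t)^{f_i\varphi}\ \middle|\ 1\le i\le s,\ t\in T_i\right)g^{\sigma}$$ is a state-closed representation of $G$ on the $m$-tree $\mathcal{T}(Y)$ (that is, $\varphi$ is a homomorphism and its image $G^\varphi$ is a state-closed subgroup of $\mathcal{A}(Y)$), and its kernel is the $\mathbf{F}$-core of $\mathbf{H}$, namely $$\left\langle K\le \bigcap_{i=1}^s H_i \ \middle|\ K\trianglelefteq G,\ K^{f_i}\le K \text{ for all } i=1,\dots,s\right\rangle .$$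
   Context: Actions are written on the right (exponent notation), and products are composed from left to right; $x^{f\varphi}$ means $(x^f)^\varphi$. For a finite set $Y$ of size $m\ge1$, $\mathcal{T}(Y)$ is the rooted $m$-tree whose vertices are the finite strings over $Y$, and $\mathcal{A}(Y)$ is its automorphism group. Every $\alpha\in\mathcal{A}(Y)$ is written $\alpha=(\alpha_y\mid y\in Y)\,\sigma(\alpha)$, where $\sigma(\alpha)\in \mathrm{Sym}(Y)$ is the action on the first level and the states $\alpha_y\in\mathcal{A}(Y)$ are determined by $(yu)^\alpha=y^{\sigma(\alpha)}u^{\alpha_y}$ for $y\in Y$ and strings $u$. The set of states $Q(\alpha)$ consists of $\alpha$ together with all elements obtained from $\alpha$ by repeatedly passing to states $\alpha_y$. A subgroup of $\mathcal{A}(Y)$ is state-closed (self-similar) if it contains $Q(\alpha)$ for each of its elements $\alpha$. With $H_i,T_i$ as in the claim, the Schreier function $\theta_i:G\times T_i\to H_i$ is $\theta_i(g,t)=t\,g\,(t')^{-1}$, where $t'\in T_i$ is the unique element with $H_it'=H_itg$. The permutation representation $\sigma:G\to\mathrm{Sym}(Y)$ is given on each $T_i$ by $t^{g^\sigma}=t'$ with the same $t'$. The recursive formula for $\varphi$ means: $g^\varphi$ acts on the first level by $g^\sigma$, and its state at $t\in T_i\subseteq Y$ is $(\theta_i(g,t)^{f_i})^\varphi$. Here $\mathbf{H}=\{H_1,\dots,H_s\}$ and $\mathbf{F}=\{f_1,\dots,f_s\}$ (families indexed by $i$). *)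

(* Defs.v *)
From HB Require Import structures.
From mathcomp Require Import all_boot perm.
From mathcomp Require Import boolp classical_sets functions cardinality.

Set Implicit Arguments.
Unset Strict Implicit.
Unset Printing Implicit Defensive.

Local Open Scope classical_set_scope.
Local Open Scope card_scope.
Local Open Scope group_scope.

Definition is_subgroup (G : groupType) (K : set G) : Prop := group_closed (mem K).

(* The vertices of the tree are the strings u : seq Y, the root is [::], and
   the edges join u to its one-letter extensions. *)
Definition tree_adj (Y : finType) (u v : seq Y) : Prop :=
  (exists y, v = rcons u y) \/ (exists y, u = rcons v y).

Definition is_tree_aut (Y : finType) (f : seq Y -> seq Y) : Prop :=
  [/\ bijective f, f [::] = [::] &
      forall u v, tree_adj (f u) (f v) <-> tree_adj u v].

Record tree_aut (Y : finType) := TreeAut {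
  aut_fun :> seq Y -> seq Y;
  aut_funP : is_tree_aut aut_fun }.

HB.instance Definition _ (Y : finType) := gen_eqMixin (tree_aut Y).
HB.instance Definition _ (Y : finType) := gen_choiceMixin (tree_aut Y).

Section TreeAutGroup.
Variable Y : finType.
Implicit Types (a b c : tree_aut Y) (u v : seq Y).

Lemma tree_aut_ext a b : (forall u, a u = b u) -> a = b.
Proof.
case: a b => [f fP] [g gP] /= /funext fg; case: _ / fg in gP *.
by congr TreeAut; exact: Prop_irrelevance.
Qed.

Fact aut_one_subproof : is_tree_aut (@id (seq Y)).
Proof. by split=> //; exists id. Qed.
Definition aut_one := TreeAut aut_one_subproof.

Fact aut_mul_subproof a b : is_tree_aut (fun u => b (a u)).
Proof.
have [[fa faK aK] a0 aE] := aut_funP a; have [[fb fbK bK] b0 bE] := aut_funP b.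
split=> [||u v]; [|by rewrite a0|by rewrite bE].
by exists (fun u => fa (fb u)) => u; rewrite ?fbK ?faK ?aK ?bK.
Qed.
(* Automorphisms act on the right, so (a * b) means first a, then b. *)
Definition aut_mul a b := TreeAut (aut_mul_subproof a b).

Fact aut_invP a : exists g : seq Y -> seq Y, cancel a g /\ cancel g a.
Proof. by have [[g gK Kg] _ _] := aut_funP a; exists g. Qed.

Fact aut_inv_subproof a : is_tree_aut (sval (cid (aut_invP a))).
Proof.
case: cid => g /= [aK gK]; have [_ a0 aE] := aut_funP a.
split=> [||u v]; [by exists a|by rewrite -{1}a0 aK|by rewrite -aE !gK].
Qed.
Definition aut_inv a := TreeAut (aut_inv_subproof a).

Fact aut_mulA : associative aut_mul.
Proof. by move=> a b c; apply: tree_aut_ext. Qed.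
Fact aut_mul1 : left_id aut_one aut_mul.
Proof. by move=> a; apply: tree_aut_ext. Qed.
Fact aut_mulr1 : right_id aut_one aut_mul.
Proof. by move=> a; apply: tree_aut_ext. Qed.
Fact aut_mulV : left_inverse aut_one aut_inv aut_mul.
Proof. by move=> a; apply: tree_aut_ext => u /=; case: cid => g /= []. Qed.
Fact aut_mulrV : right_inverse aut_one aut_inv aut_mul.
Proof. by move=> a; apply: tree_aut_ext => u /=; case: cid => g /= []. Qed.

HB.instance Definition _ := isGroup.Build (tree_aut Y)
  aut_mulA aut_mul1 aut_mulr1 aut_mulV aut_mulrV.

Lemma aut_rcons a u y : exists z, a (rcons u y) = rcons (a u) z.
Proof.
have [abij a0 aE] := aut_funP a.
elim/last_ind: u y => [|u x IHu] y.
  have /aE : tree_adj [::] [:: y] by left; exists y.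
  by rewrite a0 => -[[z ->]|[z]]; [exists z | case: (a _)].
have /aE : tree_adj (rcons u x) (rcons (rcons u x) y) by left; exists y.
case=> [[z ->]|[z]]; first by exists z.
have [w ->] := IHu x; move/rcons_inj=> [/(bij_inj abij) /(congr1 size) eq_sz _].
by move/eqP: eq_sz; rewrite !size_rcons eqn_leq andbC ltnNge ltnW.
Qed.

Lemma aut_cat a u v : exists2 w, a (u ++ v) = a u ++ w & size w = size v.
Proof.
elim/last_ind: v => [|v y [w aw sw]]; first by exists [::]; rewrite ?cats0.
have [z az] := aut_rcons a (u ++ v) y.
by exists (rcons w z); rewrite ?size_rcons ?sw // -rcons_cat az aw rcons_cat.
Qed.

Definition aut_letter a y := head y (a [:: y]).
Definition aut_tail a y u := behead (a (y :: u)).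

Lemma aut_letterE a y : a [:: y] = [:: aut_letter a y].
Proof.
have [_ a0 _] := aut_funP a; have [z] := aut_rcons a [::] y.
by rewrite /aut_letter /= a0 => ->.
Qed.

Lemma aut_consE a y u : a (y :: u) = aut_letter a y :: aut_tail a y u.
Proof.
have [w + _] := aut_cat a [:: y] u.
by rewrite /aut_tail cat1s aut_letterE => ->.
Qed.

Fact aut_perm_subproof a : injective (aut_letter a).
Proof.
have [[g gK _] _ _] := aut_funP a; move=> x y xy.
by have := gK [:: x]; rewrite aut_letterE xy -aut_letterE gK => -[].
Qed.

Definition aut_perm a : {perm Y} := perm (@aut_perm_subproof a).

Fact aut_tailK a y : cancel (aut_tail a y) (aut_tail a^-1 (aut_letter a y)).
Proof.
move=> u; have aK : a^-1 (a (y :: u)) = y :: u.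
  by rewrite -[LHS]/((a * a^-1) (y :: u)) mulgV.
by rewrite /aut_tail -/(aut_tail a y u) -aut_consE aK.
Qed.

Fact aut_state_subproof a y : is_tree_aut (aut_tail a y).
Proof.
have [_ a0 aE] := aut_funP a.
have adj_cons x u v : tree_adj (x :: u) (x :: v) <-> tree_adj u v.
  have consP (p q : seq Y) : (exists z, x :: q = rcons (x :: p) z) =
                             (exists z, q = rcons p z).
    by apply/propext; split=> -[z]; [case=> ->|move=> ->]; exists z.
  by rewrite /tree_adj !consP.
split=> [||u v]; last first.
- apply: iff_trans (adj_cons y u v); apply: iff_trans (aE _ _).
  by rewrite !aut_consE; apply: iff_sym; apply: adj_cons.
- by rewrite /aut_tail aut_letterE.
exists (aut_tail a^-1 (aut_letter a y)); first exact: aut_tailK.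
have yE : aut_letter a^-1 (aut_letter a y) = y.
  have : a^-1 (a [:: y]) = [:: y].
    by rewrite -[LHS]/((a * a^-1) [:: y]) mulgV.
  by rewrite !aut_letterE => -[].
by move=> u; have := aut_tailK a^-1 (aut_letter a y) u; rewrite invgK yE.
Qed.

Definition aut_state a y := TreeAut (aut_state_subproof a y).

Lemma aut_decomposition a y u : a (y :: u) = aut_perm a y :: aut_state a y u.
Proof. by rewrite permE aut_consE. Qed.

Inductive states a : set (tree_aut Y) :=
| states_self : states a a
| states_step b y : states a b -> states a (aut_state b y).

Definition state_closed (M : set (tree_aut Y)) : Prop :=
  is_subgroup M /\ forall a, M a -> states a `<=` M.

End TreeAutGroup.

Section Schreier.
Variable G : groupType.

Definition right_coset (H : set G) (x : G) : set G := [set h * x | h in H].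

Definition has_index (H : set G) (n : nat) : Prop :=
  range (right_coset H) #= `I_n.

(* G is the disjoint union of the n cosets H t_j; in particular the t_j are
   pairwise distinct. *)
Definition right_transversal (H : set G) n (t : 'I_n -> G) : Prop :=
  trivIset setT (fun j => right_coset H (t j)) /\
  \bigcup_j right_coset H (t j) = setT.

Definition normal_subgroup (K : set G) : Prop :=
  is_subgroup K /\ forall x g, K x -> K (x ^ g).

Variables (s : nat) (m : 'I_s -> nat).
Variables (H : 'I_s -> set G) (f : 'I_s -> G -> G).
Variable t : forall i, 'I_(m i) -> G.

(* Y: the letter (i, j) is the element t_ij of T_i in the disjoint union. *)
Definition letter : finType := {i : 'I_s & 'I_(m i)}.

(* The index of the representative t' of the coset H_i t_ij g. The default j is
   irrelevant: t' exists as soon as t i is a right transversal of H i. *)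
Definition schreier_rep (i : 'I_s) (g : G) (j : 'I_(m i)) : 'I_(m i) :=
  xget j [set k | right_coset (H i) (t k) = right_coset (H i) (t j * g)].

Definition theta (i : 'I_s) (g : G) (j : 'I_(m i)) : G :=
  t j * g * (t (schreier_rep g j))^-1.

Definition sigma (g : G) (y : letter) : letter :=
  Tagged (fun i => 'I_(m i)) (schreier_rep g (tagged y)).

(* f i stands for a homomorphism defined on H i only; it is applied here to an
   element of H i. *)
Definition recursive_formula (phi : G -> tree_aut letter) : Prop :=
  forall g : G,
    aut_perm (phi g) =1 sigma g /\
    forall i (j : 'I_(m i)),
      aut_state (phi g) (Tagged (fun i => 'I_(m i)) j) = phi (f i (theta g j)).

Definition F_core : set G :=
  smallest (@is_subgroup G)
    (\bigcup_(K in [set K : set G |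
        [/\ K `<=` \bigcap_i H i, normal_subgroup K
           & forall i, f i @` K `<=` K]]) K).

End Schreier.

(* Main.v *)
Require Import Defs.
From HB Require Import structures.
From mathcomp Require Import all_boot perm.
From mathcomp Require Import boolp classical_sets functions cardinality.

(** Reading the recursive formula one letter at a time turns it into a
    structural recursion on strings: the image of y :: u under g is the letter
    sigma g y followed by the image of u under f (theta g y).  The recursion
    computes every solution of the formula, so there is at most one solution
    ([recursive_formulaE]), and its value [act] is the only candidate.

    The maps [act g] form a right action of G because of the cocycle identity
    theta (g h) t = theta g t * theta h t', where t' represents the coset of
    t g ([theta_mul]), an identity between elements of H_i, where f_i is
    multiplicative.  Hence [act g] has the inverse [act g^-1]; it maps
    extensions of a string to extensions of its image, so it is a tree
    automorphism, and g |-> [act g] is the required representation.  The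
    formula says that the states of an element of its image lie in the image.

    For the kernel, let g act trivially.  Then g fixes the letter t0 of T_i
    that represents H_i itself; as t0 lies in H_i, so does g, and the state
    of g at t0, the image of f_i (t0 g t0^-1), is trivial; this is the image
    of a conjugate of f_i g, so f_i g acts trivially too.  Thus the kernel is
    one of the subgroups K that generate the F-core.  Conversely, let g lie in
    such a K.  Each t g t^-1 lies in K, hence in H_i, so g fixes every letter
    and has its states in the image of K; by induction on strings, g acts
    trivially. *)

Set Implicit Arguments.
Unset Strict Implicit.

Local Open Scope classical_set_scope.
Local Open Scope group_scope.

(** * Subgroups, cosets and maps multiplicative on a subgroup *)

Section Subgroup.
Context {G : groupType} {H : set G}.
Hypothesis H_subgroup : is_subgroup H.

Lemma subgroup1 : H 1.
Proof. by have [/set_mem] := H_subgroup. Qed.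

Lemma subgroup_div x y : H x -> H y -> H (x * y^-1).
Proof.
have [_ HB] := H_subgroup.
by move=> Hx Hy; apply: set_mem; apply: HB; apply: mem_set.
Qed.

Lemma subgroupV x : H x -> H x^-1.
Proof. by move=> Hx; rewrite -[x^-1]mul1g; apply: subgroup_div subgroup1 _. Qed.

Lemma subgroupM x y : H x -> H y -> H (x * y).
Proof. by move=> Hx /subgroupV Hy; rewrite -[y]invgK; apply: subgroup_div. Qed.

Lemma subgroupJ x y : H x -> H y -> H (x ^ y).
Proof.
move=> Hx Hy; rewrite conjgE; apply: subgroupM; first exact: subgroupV.
exact: subgroupM.
Qed.

Lemma eq_right_coset x y :
  right_coset H x = right_coset H y <-> H (x * y^-1).
Proof.
split=> [eq_xy | Hxy].
  have : right_coset H x x by exists 1; rewrite ?mul1g //; exact: subgroup1.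
  by rewrite eq_xy => -[h Hh <-]; rewrite mulgK.
apply/seteqP; split=> z [h Hh <-].
  exists (h * (x * y^-1)); first exact: subgroupM.
  by rewrite -!mulgA mulVg mulg1.
exists (h * (x * y^-1)^-1); first exact: subgroup_div.
by rewrite invgM invgK -!mulgA mulVg mulg1.
Qed.

Section MorphismOn.
Context {K : groupType} {f : G -> K}.
Hypothesis f_hom : {in H &, {morph f : x y / x * y}}.

Lemma morph_onM x y : H x -> H y -> f (x * y) = f x * f y.
Proof. by move=> Hx Hy; apply: f_hom; apply: mem_set. Qed.

Lemma morph_on1 : f 1 = 1.
Proof.
by apply: (mulgI (f 1)); rewrite -morph_onM ?mulg1 //; exact: subgroup1.
Qed.

Lemma morph_onV x : H x -> f x^-1 = (f x)^-1.
Proof.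
move=> Hx; apply: (mulgI (f x)).
by rewrite -morph_onM ?mulgV ?morph_on1 //; exact: subgroupV.
Qed.

Lemma morph_onJ x y : H x -> H y -> f (x ^ y) = f x ^ f y.
Proof.
move=> Hx Hy; rewrite !conjgE !morph_onM ?morph_onV //.
  exact: subgroupV.
exact: subgroupM.
Qed.

End MorphismOn.
End Subgroup.

Lemma is_subgroup_setT (G : groupType) : is_subgroup [set: G].
Proof. by split=> [|x y _ _]; apply: mem_set. Qed.

(** * The Schreier function is a cocycle *)

Section Representation.
Context {G : groupType} {s : nat} {m : 'I_s -> nat}.
Context {H : 'I_s -> set G} {f : 'I_s -> G -> G}.
Context {t : forall i, 'I_(m i) -> G}.
Arguments t : clear implicits.
Hypothesis H_subgroup : forall i, is_subgroup (H i).
Hypothesis f_hom : forall i, {in H i &, {morph f i : x y / x * y}}.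
Hypothesis t_transversal : forall i, right_transversal (H i) (t i).

Local Notation theta := (theta H t).
Local Notation schreier_rep := (schreier_rep H t).
Local Notation sigma := (sigma H t).

Lemma transversal_inj i j k : H i (t i j * (t i k)^-1) -> j = k.
Proof.
have [triv _] := t_transversal i.
move/(eq_right_coset (H_subgroup i)) => eq_jk; apply: triv => //.
exists (t i j); split; last rewrite -eq_jk.
all: by exists 1; [exact: subgroup1 | exact: mul1g].
Qed.

Lemma transversal_cover i x : exists k, H i (x * (t i k)^-1).
Proof.
have [_ cover] := t_transversal i.
have : (\bigcup_j right_coset (H i) (t i j)) x by rewrite cover.
by move=> [k _ [h Hh <-]]; exists k; rewrite mulgK.
Qed.

Lemma theta_in i g (j : 'I_(m i)) : H i (theta g j).
Proof.
apply/(eq_right_coset (H_subgroup i)); apply: esym.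
apply: (@xgetPex _ j [set k | right_coset (H i) (t i k)
                            = right_coset (H i) (t i j * g)]).
have [k Hk] := transversal_cover i (t i j * g).
by exists k; apply/esym/(eq_right_coset (H_subgroup i)).
Qed.

(** Every identity between coset representatives below comes down to a
    membership in H_i: it is enough to exhibit t_k as a representative of the
    coset of t_j g. *)
Lemma schreier_rep_unique i g (j k : 'I_(m i)) :
  H i (t i j * g * (t i k)^-1) -> schreier_rep g j = k.
Proof.
move=> Hk; apply: transversal_inj.
have := subgroup_div (H_subgroup i) (subgroupV (H_subgroup i) (theta_in g j))
  (subgroupV (H_subgroup i) Hk).
by rewrite /theta !invgM !invgK -!mulgA !mulKg.
Qed.

(** The intermediate representative cancels.  As the left-hand side lies in
    H_i, this identity shows which coset contains t_j g h, and once that is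
    known it becomes the cocycle identity. *)
Lemma theta_concat i g h (j : 'I_(m i)) :
  theta g j * theta h (schreier_rep g j) =
  t i j * (g * h) * (t i (schreier_rep h (schreier_rep g j)))^-1.
Proof. by rewrite /theta -!mulgA mulKg. Qed.

Lemma schreier_rep_mul i g h (j : 'I_(m i)) :
  schreier_rep (g * h) j = schreier_rep h (schreier_rep g j).
Proof.
apply: schreier_rep_unique; rewrite -theta_concat.
by apply: (subgroupM (H_subgroup i)); apply: theta_in.
Qed.

Lemma theta_mul i g h (j : 'I_(m i)) :
  theta (g * h) j = theta g j * theta h (schreier_rep g j).
Proof. by rewrite theta_concat -schreier_rep_mul. Qed.

Lemma schreier_rep1 i (j : 'I_(m i)) : schreier_rep 1 j = j.
Proof.
by apply: schreier_rep_unique; rewrite mulg1 mulgV; apply: subgroup1.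
Qed.

Lemma theta_fix i g (j : 'I_(m i)) :
  schreier_rep g j = j -> theta g j = g ^ (t i j)^-1.
Proof. by rewrite /theta conjgE invgK mulgA => ->. Qed.

(** * The representation defined by the recursive formula *)

Fixpoint act (g : G) (u : seq (letter m)) : seq (letter m) :=
  if u is y :: v
  then sigma g y :: act (f (tag y) (theta g (tagged y))) v
  else [::].

Lemma act1 u : act 1 u = u.
Proof.
elim: u => //= -[i j] u IHu; congr (_ :: _).
  by rewrite /sigma /= schreier_rep1.
rewrite /= theta_fix ?schreier_rep1 // conj1g.
by rewrite (morph_on1 (H_subgroup i) (@f_hom i)).
Qed.

Lemma actM g h u : act (g * h) u = act h (act g u).
Proof.
elim: u g h => //= -[i j] u IHu g h; congr (_ :: _).
  by rewrite /sigma /= schreier_rep_mul.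
by rewrite /= theta_mul (morph_onM (@f_hom i)) ?IHu //; apply: theta_in.
Qed.

Lemma actK g : cancel (act g) (act g^-1).
Proof. by move=> u; rewrite -actM mulgV act1. Qed.

Lemma act_rcons g u y : exists z, act g (rcons u y) = rcons (act g u) z.
Proof.
elim: u g => [|x u IHu] g /=; first by exists (sigma g y).
by have [z ->] := IHu (f (tag x) (theta g (tagged x))); exists z.
Qed.

Lemma act_adj g u v : tree_adj u v -> tree_adj (act g u) (act g v).
Proof.
case=> -[y ->].
  by have [z ->] := act_rcons g u y; left; exists z.
by have [z ->] := act_rcons g v y; right; exists z.
Qed.

Lemma act_is_tree_aut g : is_tree_aut (act g).
Proof.
split=> // [|u v].
  exists (act g^-1); first exact: actK.
  by move=> u; rewrite -{1}[g]invgK actK.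
(* act g reflects adjacency because its inverse act g^-1 preserves it. *)
by split=> [/(act_adj g^-1)|/(act_adj g) //]; rewrite !actK.
Qed.

Definition rep (g : G) : tree_aut (letter m) := TreeAut (act_is_tree_aut g).

Lemma rep_recursive : recursive_formula H f t rep.
Proof.
move=> g; split=> [y|i j]; first by rewrite permE.
exact: tree_aut_ext.
Qed.

(** An automorphism is determined by its permutation of the letters and its
    states, so the formula prescribes the image of a string letter by letter. *)
Lemma recursive_formulaE phi g u :
  recursive_formula H f t phi -> phi g u = act g u.
Proof.
move=> phiP; elim: u g => [|[i j] u IHu] g.
  by have [_ -> _] := aut_funP (phi g).
have [permE stateE] := phiP g.
by rewrite aut_decomposition permE stateE IHu.
Qed.

Lemma rep_unique : unique (recursive_formula H f t) rep.
Proof.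
split=> [|phi phiP]; first exact: rep_recursive.
apply: funext => g; apply: tree_aut_ext => u.
by rewrite (recursive_formulaE _ _ phiP).
Qed.

Lemma repM : {morph rep : x y / x * y}.
Proof. by move=> g h; apply: tree_aut_ext => u; apply: actM. Qed.

Lemma rep1 : rep 1 = 1.
Proof. by apply: tree_aut_ext; apply: act1. Qed.

Lemma repV g : rep g^-1 = (rep g)^-1.
Proof.
apply: (morph_onV (is_subgroup_setT G)) I.
by move=> x y _ _; exact: repM.
Qed.

Lemma rep_state_closed : state_closed (range rep).
Proof.
split.
  split; first by apply: mem_set; exists 1; rewrite ?rep1.
  move=> _ _ /set_mem[g _ <-] /set_mem[h _ <-]; apply: mem_set.
  by exists (g * h^-1); rewrite ?repM ?repV.
move=> a ra b; elim=> // {}b [i j] _ [g _ <-].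
by have [_ ->] := rep_recursive g; exists (f i (theta g j)).
Qed.

(** * The kernel *)

Local Notation ker := [set g | rep g = 1].

Lemma ker_normal : normal_subgroup ker.
Proof.
split; last first.
  by move=> x g /= kx; rewrite conjgE !repM kx mul1g -repM mulVg rep1.
split; first by apply: mem_set; apply: rep1.
move=> x y /set_mem /= kx /set_mem /= ky; apply: mem_set => /=.
by rewrite repM repV kx ky mulgV.
Qed.

Lemma ker_schreier_rep i g (j : 'I_(m i)) : rep g = 1 -> schreier_rep g j = j.
Proof.
move=> kg; have /= : rep g [:: Tagged (fun i => 'I_(m i)) j] = [:: Tagged _ j].
  by rewrite kg.
by move/(congr1 (head (Tagged _ j))) => /eqP; rewrite /= eq_Tagged => /eqP.
Qed.

Lemma ker_theta i g (j : 'I_(m i)) : rep g = 1 -> rep (f i (theta g j)) = 1.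
Proof.
move=> kg; apply: tree_aut_ext => u.
have : rep g (Tagged (fun i => 'I_(m i)) j :: u) = Tagged _ j :: u by rewrite kg.
by case.
Qed.

(** Conjugation by such a t_j preserves H_i and f_i is multiplicative at it,
    so that facts about theta g j, a conjugate of g by t_j when g is in the
    kernel, descend to g. *)
Lemma transversal_unit i : exists j, H i (t i j).
Proof.
have [j Hj] := transversal_cover i 1; exists j.
by rewrite -[t i j]invgK -[(t i j)^-1]mul1g; apply: (subgroupV (H_subgroup i)).
Qed.

Lemma ker_sub i g : rep g = 1 -> H i g.
Proof.
move=> kg; have [j Hj] := transversal_unit i.
have := theta_in g j; rewrite theta_fix ?ker_schreier_rep // => Hg.
by rewrite -(conjgKV (t i j) g); apply: (subgroupJ (H_subgroup i)).
Qed.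

Lemma ker_stable i g : rep g = 1 -> rep (f i g) = 1.
Proof.
move=> kg; have [j Hj] := transversal_unit i.
have := ker_theta j kg; rewrite theta_fix ?ker_schreier_rep //.
rewrite (morph_onJ (H_subgroup i) (@f_hom i)).
- have [_ kerJ] := ker_normal => /kerJ kJ.
  by rewrite -(conjgK (f i (t i j)^-1) (f i g)); apply: kJ.
- exact: ker_sub.
- exact: (subgroupV (H_subgroup i)).
Qed.

(** Normality puts t g t^-1 in K, hence in H_i, so t g lies in H_i t and g
    fixes the letter t; as f_i maps t g t^-1 into K again, the same argument
    applies at the next level. *)
Lemma normal_stable_act K g u :
  K `<=` \bigcap_i H i -> normal_subgroup K ->
  (forall i, f i @` K `<=` K) -> K g -> act g u = u.
Proof.
move=> KH [_ KJ] Kf; elim: u g => //= -[i j] u IHu g Kg.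
have Kc : K (g ^ (t i j)^-1) by apply: KJ.
have fixj : schreier_rep g j = j.
  apply: schreier_rep_unique; have := KH _ Kc i I.
  by rewrite conjgE invgK mulgA.
rewrite /sigma /= fixj IHu // theta_fix //.
by apply: Kf; exists (g ^ (t i j)^-1).
Qed.

Lemma ker_F_core : ker = F_core H f.
Proof.
apply/seteqP; split.
  apply: sub_smallest => g kg; exists ker => //.
  split=> [x kx i _||i _ [x kx <-]].
  - exact: ker_sub.
  - exact: ker_normal.
  - exact: ker_stable.
apply: smallest_sub; first by have [] := ker_normal.
move=> g [K [KH Knormal Kf] Kg]; apply: tree_aut_ext => u.
exact: (normal_stable_act u KH).
Qed.

End Representation.

Lemma card_letter s (m : 'I_s -> nat) : #|letter m| = (\sum_(i < s) m i)%N.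
Proof.
rewrite card_tagged sumnE big_map big_enum /=.
by apply: eq_bigr => i _; rewrite card_ord.
Qed.

Theorem propositionA (G : groupType) (s : nat) (m : 'I_s -> nat)
    (H : 'I_s -> set G) (f : 'I_s -> G -> G) (t : forall i, 'I_(m i) -> G)
    (s_ge1 : (1 <= s)%N)
    (m_ge1 : forall i, (1 <= m i)%N)
    (H_subgroup : forall i, is_subgroup (H i))
    (H_index : forall i, has_index (H i) (m i))
    (f_hom : forall i, {in H i &, {morph f i : x y / x * y}})
    (t_transversal : forall i, right_transversal (H i) (t i)) :
  #|letter m| = (\sum_(i < s) m i)%N /\
  exists phi : G -> tree_aut (letter m),
    [/\ unique (recursive_formula H f t) phi,
        {morph phi : x y / x * y},
        state_closed (range phi) &
        [set g | phi g = 1] = F_core H f].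
Proof.
split; first exact: card_letter.
exists (rep H_subgroup f_hom t_transversal); split.
- exact: rep_unique.
- exact: repM.
- exact: rep_state_closed.
- exact: ker_F_core.
Qed.
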